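(* Let $n,t$ be positive integers and let $G$ be a graph such that every red/blue-coloring of the edges of $G$ contains either an induced copy of $K_{1,t}$ all of whose edges are red or an induced copy of $M_n$ all of whose edges are blue. Then $G$ contains a subgraph which is an $(n,t)$-Ruzsa--Szemerédi graph.
   Context: $K_{1,t}$ is the star with $t$ edges and $M_n$ is the matching with $n$ edges. An induced copy of $H$ in $G$ is a subgraph $H'\cong H$ of $G$ such that two vertices of $H'$ are adjacent in $H'$ iff they are adjacent in $G$. A graph is an $(n,t)$-Ruzsa--Szemerédi graph if its edge set is the union of $t$ pairwise disjoint induced matchings (in that graph), each of size $n$. *)

(* Defs.v *)
From mathcomp Require Import all_boot.

Set Implicit Arguments.
Unset Strict Implicit.
Unset Printing Implicit Defensive.

(* A finite simple graph, carried by a vertex set inside an ambient finite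
   type so that the subgraphs of a graph are again graphs on the same type.
   Edges are two-element sets of vertices. *)
Record graph (T : finType) := Graph {
  verts : {set T};
  edges : {set {set T}};
  edgesP : [forall e in edges, (#|e| == 2) && (e \subset verts)]
}.

Definition adj (T : finType) (G : graph T) (x y : T) : bool :=
  [set x; y] \in edges G.

Definition subgraph (T : finType) (H G : graph T) : Prop :=
  verts H \subset verts G /\ edges H \subset edges G.

Definition isomorphic (U T : finType) (H : graph U) (K : graph T) : Prop :=
  exists f : U -> T,
    [/\ {in verts H &, injective f},
        f @: verts H = verts K
      & {in verts H &, forall x y, adj K (f x) (f y) = adj H x y}].

Definition induced_copy (U T : finType) (H : graph U) (H' G : graph T) : Prop :=
  [/\ subgraph H' G,
      isomorphic H H'
    & {in verts H' &, forall x y, adj H' x y = adj G x y}].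

Definition star_edges (t : nat) : {set {set option 'I_t}} :=
  [set [set None; Some i] | i : 'I_t].

Fact star_edgesP (t : nat) :
  [forall e in star_edges t, (#|e| == 2) && (e \subset [set: option 'I_t])].
Proof.
by apply/forall_inP => _ /imsetP[i _ ->]; rewrite cards2 subsetT.
Qed.

Definition star (t : nat) : graph (option 'I_t) := Graph (star_edgesP t).

Definition matching_edges (n : nat) : {set {set 'I_n * bool}} :=
  [set [set (i, false); (i, true)] | i : 'I_n].

Fact matching_edgesP (n : nat) :
  [forall e in matching_edges n,
     (#|e| == 2) && (e \subset [set: 'I_n * bool])].
Proof.
apply/forall_inP => _ /imsetP[i _ ->].
by rewrite cards2 subsetT xpair_eqE eqxx.
Qed.

Definition matching (n : nat) : graph ('I_n * bool)%type :=
  Graph (matching_edgesP n).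

Definition ruzsa_szemeredi (n t : nat) (T : finType) (F : graph T) : Prop :=
  exists M : 'I_t -> graph T,
    [/\ forall i, induced_copy (matching n) (M i) F,
        forall i j, i != j -> [disjoint edges (M i) & edges (M j)]
      & edges F = \bigcup_(i < t) edges (M i)].

Variant color := Red | Blue.

(* Only the values of a coloring on the edges of the graph matter. *)
Definition monochromatic (T : finType) (c : {set T} -> color) (a : color)
    (H : graph T) : Prop :=
  forall e, e \in edges H -> c e = a.

(* Main.v *)
Require Import Defs.
From mathcomp Require Import all_boot.

(** Suppose [k < t] pairwise disjoint induced copies of [M_n] have been found in
    [G]. Color their edges red and all other edges blue. Every vertex meets at
    most one edge of each copy, so its red degree is at most [k < t] and there is
    no red [K_{1,t}]; hence there is a blue induced [M_n], which is disjoint from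
    the previous copies. After [t] rounds, the union of the copies is the desired
    subgraph: a matching induced in [G] is induced in any intermediate graph. *)

Lemma adj_verts (T : finType) (G : graph T) (x y : T) :
  adj G x y -> (x \in verts G) * (y \in verts G).
Proof.
move=> xy; have /forall_inP /(_ _ xy) /andP[_ /subsetP sub] := edgesP G.
by rewrite !sub // !inE eqxx ?orbT.
Qed.

Lemma adj_matchingE (n : nat) (u v : 'I_n * bool) :
  adj (matching n) u v -> v = (u.1, ~~ u.2).
Proof.
move=> uv; have /forall_inP /(_ _ uv) /andP[+ _] := edgesP (matching n).
case/imsetP: uv => i _ E; rewrite cards2.
have: u \in [set u; v] by rewrite !inE eqxx.
have: v \in [set u; v] by rewrite !inE eqxx orbT.
(* Of the four cases, the two with [u = v] contradict the cardinality 2 of an edge. *)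
by rewrite E !inE => /orP[] /eqP-> /orP[] /eqP->; rewrite ?eqxx.
Qed.

(** Pulled back to [matching n], both neighbours become the vertex obtained by flipping the boolean
    of the preimage of [x]. *)
Lemma matching_nbr_uniq (n : nat) (T : finType) (K : graph T) (x y z : T) :
  isomorphic (matching n) K -> adj K x y -> adj K x z -> y = z.
Proof.
move=> [f [_ imf adjf]] xy xz.
have [] := (adj_verts _ _ _ _ xy, adj_verts _ _ _ _ xz).
rewrite -imf => -[/imsetP[u uK xE] /imsetP[v vK yE]] [_ /imsetP[w wK zE]].
move: xy xz; rewrite xE yE zE !adjf //.
by move=> /adj_matchingE-> /adj_matchingE->.
Qed.

(** Pigeonhole: send each leaf to a matching containing its edge. Two leaves with the same matching
    would both be neighbours of the centre there, so this map is injective and [t <= k]. *)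
Lemma star_not_covered (n k t : nat) (T : finType) (M : nat -> graph T)
    (H : graph T) :
  k < t -> (forall i, i < k -> isomorphic (matching n) (M i)) ->
  isomorphic (star t) H -> ~~ (edges H \subset \bigcup_(i < k) edges (M i)).
Proof.
move=> ltkt Miso [f [finj _ adjf]]; apply/negP => /subsetP cov.
have cov_leaf (a : 'I_t) : exists i : 'I_k, adj (M i) (f None) (f (Some a)).
  have /cov /bigcupP[i _ ei] : adj H (f None) (f (Some a)).
    by rewrite adjf ?inE //; apply: imset_f.
  by exists i.
pose g a := xchoose (cov_leaf a).
have ginj : injective g.
  move=> a b gab; have := xchooseP (cov_leaf a); have := xchooseP (cov_leaf b).
  rewrite -/(g a) -/(g b) gab => yb ya.
  have /finj := matching_nbr_uniq _ _ _ _ _ _ (Miso _ (ltn_ord (g b))) ya yb.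
  by rewrite !inE => /(_ isT isT) [].
by have := leq_card _ ginj; rewrite !card_ord leqNgt ltkt.
Qed.

(** Indexing by [nat] lets each round extend the family without casts between ordinals. With pairs
    ordered as [i < j], a new copy only occurs as [M j]. *)
Lemma disjoint_induced_matchings (n t : nat) (T : finType) (G : graph T)
    (G_ramsey : forall c : {set T} -> color,
       (exists H : graph T,
          induced_copy (star t) H G /\ monochromatic c Red H) \/
       (exists H : graph T,
          induced_copy (matching n) H G /\ monochromatic c Blue H))
    (k : nat) :
  k <= t -> exists M : nat -> graph T,
    (forall i, i < k -> induced_copy (matching n) (M i) G) /\
    (forall i j, i < j -> j < k -> [disjoint edges (M j) & edges (M i)]).
Proof.
(* For [k = 0] no index is constrained, so [G] is a mere default value. *)
elim: k => [|k IHk] lekt; first by exists (fun=> G).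
have [M [Mind Mdis]] := IHk (ltnW lekt).
pose R := \bigcup_(i < k) edges (M i).
have [[H [[_ Hiso _] Hred]]|[H [Hind Hblue]]] :=
  G_ramsey (fun e => if e \in R then Red else Blue).
  have /negP[] : ~~ (edges H \subset R).
    by apply: (star_not_covered n k t) => // i /Mind[].
  by apply/subsetP => e /Hred; case: ifP.
have Hdis i : i < k -> [disjoint edges H & edges (M i)].
  move=> ltik; rewrite disjoint_subset; apply/subsetP => e /Hblue.
  rewrite inE /=; case: ifP => // /negbT + _; apply: contra => ei.
  by apply/bigcupP; exists (Ordinal ltik).
exists (fun i => if i == k then H else M i); split=> [i | i j ltij].
  by rewrite ltnS leq_eqVlt; case: eqP => //= _; apply: Mind.
rewrite ltnS leq_eqVlt; case: eqP => /= [jk _ | _ ltjk].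
  by rewrite jk in ltij; rewrite ltn_eqF // Hdis.
by rewrite ltn_eqF ?(ltn_trans ltij) // Mdis.
Qed.

Lemma induced_copy_intermediate (U T : finType) (K : graph U)
    (H F G : graph T) :
  subgraph H F -> subgraph F G -> induced_copy K H G -> induced_copy K H F.
Proof.
move=> sHF [_ /subsetP sFG] [_ isoH indH]; split=> // x y xH yH.
apply/idP/idP => [|/sFG]; last by rewrite indH.
by case: sHF => _ /subsetP; apply.
Qed.

Theorem theorem6p1 (n t : nat) (n_gt0 : 0 < n) (t_gt0 : 0 < t)
    (T : finType) (G : graph T)
    (G_ramsey : forall c : {set T} -> color,
       (exists H : graph T,
          induced_copy (star t) H G /\ monochromatic c Red H) \/
       (exists H : graph T,
          induced_copy (matching n) H G /\ monochromatic c Blue H)) :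
  exists F : graph T, subgraph F G /\ ruzsa_szemeredi n t F.
Proof.
have [M [Mind Mdis]] := disjoint_induced_matchings _ _ _ _ G_ramsey _ (leqnn t).
pose E := \bigcup_(i < t) edges (M i).
have sEG : E \subset edges G.
  by apply/bigcupsP => i _; case: (Mind i (ltn_ord i)) => -[].
(* The subgraph keeps all vertices of [G]; only its edges are restricted to [E]. *)
have EP : [forall e in E, (#|e| == 2) && (e \subset verts G)].
  apply/forall_inP => e /(subsetP sEG).
  by move: e; apply/forall_inP; apply: edgesP.
have sFG : subgraph (Graph EP) G by split.
exists (Graph EP); split=> //.
exists (fun i => M i); split=> // [i | i j].
  have Mi := Mind i (ltn_ord i); apply: induced_copy_intermediate (sFG) (Mi).
  by split; [case: Mi => -[] | apply: (bigcup_sup i)].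
rewrite -val_eqE neq_ltn => /orP[] ltij; last exact: Mdis.
by rewrite disjoint_sym Mdis.
Qed.
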